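(* Let $n, N\ge 1$ be integers and let $\mathbf{S}$ be an $(nN)\times(nN)$ complex matrix partitioned into $N^2$ blocks $\mathbf{S}_{ij}$ ($1\le i,j\le N$), each of size $n\times n$: $$\mathbf{S} = \begin{bmatrix} \mathbf{S}_{11} & \mathbf{S}_{12} & \cdots & \mathbf{S}_{1N} \\ \mathbf{S}_{21} & \mathbf{S}_{22} & \cdots & \mathbf{S}_{2N} \\ \vdots & \vdots & \ddots & \vdots \\ \mathbf{S}_{N1} & \mathbf{S}_{N2} & \cdots & \mathbf{S}_{NN} \end{bmatrix}.$$ Define recursively block matrices $\boldsymbol{\alpha}^{(0)},\boldsymbol{\alpha}^{(1)},\dots,\boldsymbol{\alpha}^{(N-1)}$, where $\boldsymbol{\alpha}^{(k)}$ is an $(N-k)\times(N-k)$ block matrix with $n\times n$ blocks $\boldsymbol{\alpha}^{(k)}_{ij}$ ($1\le i,j\le N-k$), by $$\boldsymbol{\alpha}^{(0)}_{ij} = \mathbf{S}_{ij}, \qquad \boldsymbol{\alpha}^{(k+1)}_{ij} = \boldsymbol{\alpha}^{(k)}_{ij} - \boldsymbol{\alpha}^{(k)}_{i,N-k}\left(\boldsymbol{\alpha}^{(k)}_{N-k,N-k}\right)^{-1}\boldsymbol{\alpha}^{(k)}_{N-k,j} \quad (0\le k\le N-2),$$ where it is assumed that all the inverses appearing here exist, i.e. $\boldsymbol{\alpha}^{(k)}_{N-k,N-k}$ is invertible for every $0\le k\le N-2$. Then $$\det(\mathbf{S}) = \prod_{k=1}^{N}\det\left(\boldsymbol{\alpha}^{(N-k)}_{kk}\right).$$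 *)

(* Defs.v *)
From HB Require Import structures.
From mathcomp Require Import all_boot all_order all_algebra.
From mathcomp Require Import reals complex.

Set Implicit Arguments.
Unset Strict Implicit.
Unset Printing Implicit Defensive.

Import GRing.Theory.

Local Open Scope ring_scope.

(* Block indices are 0-based: the ordinal of value i stands for the
   mathematical index i + 1.  A matrix of size \sum_(i < N) n (= N * n) is cut
   into N^2 blocks of size n by submxblock. *)

Lemma last_block_subproof (N k : nat) : (k < N)%N -> (N - k.+1 < N - k)%N.
Proof. by move=> kN; rewrite ltn_sub2l. Qed.

(* The mathematical index N - k. *)
Definition last_block (N k : nat) (kN : (k < N)%N) : 'I_(N - k) :=
  Ordinal (last_block_subproof kN).

Lemma ord_sub_lt (N k : nat) (i : 'I_(N - k)) : (k < N)%N.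
Proof. by rewrite -subn_gt0; apply: leq_ltn_trans (ltn_ord i). Qed.

(* In passing from step k to step k + 1, the index range is nonempty only when
   k + 1 < N, so any index i witnesses the existence of the pivot N - k. *)
Fixpoint alpha (F : fieldType) (n N : nat) (S : 'M[F]_(\sum_(i < N) n))
    (k : nat) : 'M['M[F]_n]_(N - k) :=
  match k with
  | 0 => \matrix_(i, j)
           submxblock S (widen_ord (leq_subr 0 N) i) (widen_ord (leq_subr 0 N) j)
  | k'.+1 => \matrix_(i, j)
      let w := widen_ord (leq_sub2l N (leqnSn k')) in
      let l := last_block (ltnW (ord_sub_lt i)) in
      alpha S k' (w i) (w j)
      - alpha S k' (w i) l *m invmx (alpha S k' l l) *m alpha S k' l (w j)
  end.

Lemma diag_block_subproof (N : nat) (k : 'I_N) : (k < N - (N - k.+1))%N.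
Proof. by rewrite subKn. Qed.

(* The block index k in a block matrix of N - (N - (k + 1)) = k + 1 block rows. *)
Definition diag_block (N : nat) (k : 'I_N) : 'I_(N - (N - k.+1)) :=
  Ordinal (diag_block_subproof k).

(* Main.v *)
(* Each elimination step replaces a block matrix by the Schur complement of its
   last diagonal block, which divides the determinant by that of the pivot;
   after N - 1 steps a single block is left.  Permuting block rows and block columns
   simultaneously preserves the determinant, so the pivot can be moved to the
   front, where mxblock_recul splits it off. *)
Require Import Defs.
From HB Require Import structures.
From mathcomp Require Import all_boot all_order all_algebra.
From mathcomp Require Import perm.
From mathcomp Require Import reals complex.

Set Implicit Arguments.
Unset Strict Implicit.
Unset Printing Implicit Defensive.

Import GRing.Theory.

Local Open Scope ring_scope.

(** Block LU factorisation: the left factor is unit lower triangular, so only the diagonal blocks of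
    the right factor contribute. *)
Lemma det_block_schur (F : comUnitRingType) (m n : nat) (A : 'M[F]_m)
    (B : 'M[F]_(m, n)) (C : 'M[F]_(n, m)) (D : 'M[F]_n) :
  A \in unitmx ->
  \det (block_mx A B C D) = \det A * \det (D - C *m invmx A *m B).
Proof.
move=> Au.
have -> : block_mx A B C D = block_mx 1%:M 0 (C *m invmx A) 1%:M
    *m block_mx A B 0 (D - C *m invmx A *m B).
  rewrite mulmx_block !mul1mx !mul0mx !addr0.
  by rewrite (mulmxKV Au) addrC subrK.
by rewrite det_mulmx det_lblock det_ublock !det1 !mul1r.
Qed.

(** Between index sets of equal size an injection is a permutation; it acts on rows and columns
    alike, so its sign occurs squared. *)
Lemma det_mxsub_inj (R : comNzRingType) (p q : nat) (f : 'I_p -> 'I_q)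
    (A : 'M[R]_q) : p = q -> injective f -> \det (mxsub f f A) = \det A.
Proof.
move=> pq; case: q / pq f A => f A f_inj.
have -> : mxsub f f A = row_perm (perm f_inj) (col_perm (perm f_inj) A).
  by apply/matrixP => i j; rewrite !mxE !permE.
rewrite row_permE col_permE !det_mulmx !det_perm mulrC -mulrA.
by rewrite odd_permV -expr2 sqrr_sign mulr1.
Qed.

Lemma det_mxblock_inj (R : comNzRingType) (n p q : nat) (s : 'I_p -> 'I_q)
    (T : 'I_q -> 'I_q -> 'M[R]_n) : p = q -> injective s ->
  \det (\mxblock_(i < p, j < p) T (s i) (s j)) =
  \det (\mxblock_(i < q, j < q) T i j).
Proof.
move=> pq s_inj.
(* [f] relabels the block by [s] and keeps the offset inside the block, so it inherits injectivity
   from [s]. *)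
pose f (x : 'I_(\sum_(i < p) n)) : 'I_(\sum_(i < q) n) :=
  @tagnat.Rank q (fun=> n) (s (tagnat.sig1 x)) (tagnat.sig2 x).
rewrite -(@det_mxsub_inj _ _ _ f); first last.
- move=> x y /(congr1 val) /eqP; rewrite /f tagnat.eq_Rank.
  case/andP => /eqP /s_inj e1 /eqP e2.
  rewrite -[x]tagnat.sig2K -[y]tagnat.sig2K.
  apply: val_inj; apply/eqP; rewrite tagnat.eq_Rank e1 eqxx.
  exact/eqP.
- by rewrite pq.
congr (\det _); apply/matrixP => x y; rewrite !mxE /f.
rewrite !tagnat.Rank1K.
by congr (T _ _ _ _); apply: val_inj; rewrite tagnat.Rank2K.
Qed.

Lemma det_castmx (R : comNzRingType) (p q : nat) (pq pq' : p = q)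
    (A : 'M[R]_p) : \det (castmx (pq, pq') A) = \det A.
Proof. by case: q / pq pq' => pq'; rewrite castmx_id. Qed.

Lemma det_mxblock1 (R : comNzRingType) (n p : nat)
    (T : 'I_p -> 'I_p -> 'M[R]_n) (l : 'I_p) : p = 1%N ->
  \det (\mxblock_(i < p, j < p) T i j) = \det (T l l).
Proof.
move=> p1; subst p; rewrite (ord1 l) mxblock_recul det_castmx.
(* Beyond the first block the size is an empty sum, equal to 0 by [big_ord0]: the remaining row has
   no entries and [D] has determinant 1. *)
set D := \mxblock_(i, j) _; have -> : \mxrow_j T ord0 (lift ord0 j) = 0.
  by apply/matrixP => i j; have := ltn_ord j; rewrite {2}big_ord0.
rewrite det_lblock; set d := \det D; suff -> : d = 1 by rewrite mulr1.
rewrite /d /D; move: (\mxblock_(_, _) _); rewrite big_ord0 => E.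
exact: det_mx00.
Qed.

Lemma det_mxblock_schur (F : comUnitRingType) (n m p : nat)
    (T : 'I_p -> 'I_p -> 'M[F]_n) (l : 'I_p) (w : 'I_m -> 'I_p) :
  p = m.+1 -> injective w -> (forall i, w i != l) -> T l l \in unitmx ->
  \det (\mxblock_(i < p, j < p) T i j) = \det (T l l) *
  \det (\mxblock_(i < m, j < m)
    (T (w i) (w j) - T (w i) l *m invmx (T l l) *m T l (w j))).
Proof.
move=> pm w_inj wl Tu.
(* [s] lists the pivot [l] first and then the indices [w i]; relabelling along it moves the pivot
   block to the top left corner. *)
pose s (i : 'I_m.+1) := oapp w l (unlift ord0 i).
have s0 : s ord0 = l by rewrite /s unlift_none.
have sl i : s (lift ord0 i) = w i by rewrite /s liftK.
have s_inj : injective s.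
  move=> i j; case: (unliftP ord0 i) => [i'|] ->;
    case: (unliftP ord0 j) => [j'|] ->; rewrite ?s0 ?sl //.
  - by move/w_inj ->.
  - by move/eqP; rewrite (negbTE (wl _)).
  - by move/esym/eqP; rewrite (negbTE (wl _)).
rewrite -(det_mxblock_inj T (esym pm) s_inj) mxblock_recul det_castmx /= s0.
rewrite det_block_schur //; congr (_ * \det _).
rewrite mxcol_mul mul_mxcol_mxrow -mxblockB.
by apply: eq_mxblock => i j; rewrite !sl.
Qed.

Lemma det_alpha0 (F : fieldType) (n N : nat) (S : 'M[F]_(\sum_(i < N) n)) :
  \det (\mxblock_(i < N - 0, j < N - 0) alpha S 0 i j) = \det S.
Proof.
rewrite -[S in RHS]submxblockK.
rewrite -(det_mxblock_inj (s := widen_ord (leq_subr 0 N))) ?subn0 //; last first.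
  by move=> i j /(congr1 (@nat_of_ord _)) ij; apply: val_inj.
by congr (\det _); apply: eq_mxblock => i j; rewrite mxE.
Qed.

(** One elimination step. The pivot index is fixed only through its value, so that both [last_block]
    and [diag_block] can serve as [l]. *)
Lemma det_alphaS (F : fieldType) (n N : nat) (S : 'M[F]_(\sum_(i < N) n))
    (k : nat) (l : 'I_(N - k)) :
  l = (N - k.+1)%N :> nat -> alpha S k l l \in unitmx ->
  \det (\mxblock_(i < N - k, j < N - k) alpha S k i j) =
  \det (alpha S k l l) *
  \det (\mxblock_(i < N - k.+1, j < N - k.+1) alpha S k.+1 i j).
Proof.
move=> lE u; pose w := @widen_ord (N - k.+1) (N - k) (leq_sub2l N (leqnSn k)).
rewrite (@det_mxblock_schur _ _ _ _ _ l w) //.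
- congr (_ * \det _); apply: eq_mxblock => i j; rewrite mxE.
  suff -> : last_block (ltnW (ord_sub_lt i)) = l by [].
  exact: val_inj.
- by rewrite subnSK ?(ord_sub_lt l).
- by move=> i j /(congr1 (@nat_of_ord _)) ij; apply: val_inj.
- by move=> i; rewrite -val_eqE /= lE ltn_eqF.
Qed.

(** Induction on the number [m] of block rows left, from the single block of the last stage back to
    the full matrix; each increment of [m] restores one pivot. *)
Lemma det_alpha_tail (F : fieldType) (n N : nat) (S : 'M[F]_(\sum_(i < N) n)) :
  (forall k (l : 'I_(N - k)), (k.+1 < N)%N -> l = (N - k.+1)%N :> nat ->
     alpha S k l l \in unitmx) ->
  forall m (mN : (m <= N)%N), (0 < m)%N ->
  \det (\mxblock_(i < N - (N - m), j < N - (N - m)) alpha S (N - m) i j) =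
  \prod_(k < m) let k' := widen_ord mN k in
    \det (alpha S (N - k'.+1) (diag_block k') (diag_block k')).
Proof.
move=> u [//|m] mN _; elim: m mN => [|m IH] mN.
  rewrite big_ord1 /=.
  by rewrite (det_mxblock1 _ (diag_block (widen_ord mN ord0))) ?subKn.
rewrite big_ord_recr /=; set b := diag_block (widen_ord mN ord_max).
(* The top index [m.+1] of the product is the last block index at stage [N - m.+2], hence the pivot
   there. *)
have bE : b = (N - (N - m.+2).+1)%N :> nat.
  by rewrite /= subnSK // subKn // ltnW.
rewrite (det_alphaS bE); last first.
  by apply: u => //; rewrite subnSK // ltn_subrL (leq_ltn_trans _ mN).
rewrite subnSK // mulrC (IH (ltnW mN)); congr (_ * _).
by apply: eq_bigr => k _; congr (\det (alpha S _ _ _)); apply: val_inj.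
Qed.

Theorem theorem3p2 (R : realType) (n N : nat) (n_ge1 : (1 <= n)%N)
    (N_ge1 : (1 <= N)%N) (S : 'M[R[i]%C]_(\sum_(i < N) n))
    (alpha_inv : forall (k : nat) (kN : (k.+1 < N)%N),
       alpha S k (last_block (ltnW kN)) (last_block (ltnW kN)) \in unitmx) :
  \det S =
    \prod_(k < N) \det (alpha S (N - k.+1) (diag_block k) (diag_block k)).
Proof.
have u k (l : 'I_(N - k)) : (k.+1 < N)%N -> l = (N - k.+1)%N :> nat ->
    alpha S k l l \in unitmx.
  move=> kN lE; suff -> : l = last_block (ltnW kN) by exact: alpha_inv.
  exact: val_inj.
(* For [m = N] the stage is [N - N], that is 0, where the block matrix is [S] itself. *)
rewrite -det_alpha0; have := det_alpha_tail u (leqnn N) N_ge1.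
rewrite subnn => ->; apply: eq_bigr => k _ /=.
by congr (\det (alpha S _ _ _)); apply: val_inj.
Qed.
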